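(* There is an algorithm solving the $(\epsilon,\delta)$-winner determination problem for the maximin voting rule with sample complexity $O\!\left(\frac{\log(m/\delta)}{\epsilon^2}\right)$.
   Context: An election has $n$ voters and $m$ candidates, each vote a complete linear order. For candidates $x,y$, $D(x,y)=N(x,y)-N(y,x)$ where $N(x,y)$ is the number of voters preferring $x$ to $y$. The maximin score of $x$ is $\min_{y\ne x}D(x,y)$; the candidate with maximum maximin score wins (ties broken by an arbitrary fixed rule). The margin of victory (MOV) is the smallest number of votes that must be changed (others kept unchanged) to change the winner. The $(\epsilon,\delta)$-winner determination problem: given the $n$ votes with MOV at least $\epsilon n$, output the winner with probability at least $1-\delta$ over the algorithm's internal randomness; the algorithm may query full votes of arbitrary voters, and the sample complexity is the number of queried votes. *)

(* Defs.v *)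
From mathcomp Require Import all_boot all_order all_algebra perm.
From mathcomp Require Import reals exp.

Set Implicit Arguments.
Unset Strict Implicit.
Unset Printing Implicit Defensive.

Import Order.TTheory GRing.Theory Num.Theory.
Local Open Scope ring_scope.

(* A complete linear order on the m candidates, encoded by its rank function:
   [v x] is the position of candidate [x], position 0 being the best. *)
Definition vote (m : nat) := 'S_m.

Definition prefers (m : nat) (v : vote m) (x y : 'I_m) : bool := (v x < v y)%N.

Definition profile (n m : nat) := {ffun 'I_n -> vote m}.

Section Maximin.

Variables n m : nat.
Implicit Types (P Q : profile n m) (x y : 'I_m).

Definition nb_prefer P x y : nat := #|[set i : 'I_n | prefers (P i) x y]|.

Definition margin P x y : int := (nb_prefer P x y)%:Z - (nb_prefer P y x)%:Z.

(* All margins are at most n, so for m >= 2 the seed n does not affect the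
   minimum. *)
Definition maximin_score P x : int :=
  \big[Order.min/n%:Z]_(y : 'I_m | y != x) margin P x y.

Definition maximin_cowinners P : {set 'I_m} :=
  [set x | [forall y, maximin_score P y <= maximin_score P x]].

(* A rule selects one candidate from a set of tied ones; it may look at the
   votes, so that no particular way of breaking ties is favoured. *)
Definition tie_rule := profile n m -> {set 'I_m} -> 'I_m.

Definition valid_tie_rule (tie : tie_rule) : Prop :=
  forall P (S : {set 'I_m}), S != set0 -> tie P S \in S.

Definition maximin_winner (tie : tie_rule) P : 'I_m :=
  tie P (maximin_cowinners P).

Definition nb_changed P Q : nat := #|[set i : 'I_n | P i != Q i]|.

(* At most n votes can be changed, so the seed n does not affect the minimum as
   soon as some profile has another winner; for the maximin rule this is the
   case whenever n >= 1 and m >= 2 (rank another candidate first everywhere). *)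
Definition margin_of_victory (win : profile n m -> 'I_m) P : nat :=
  \big[minn/n]_(Q : profile n m | win Q != win P) nb_changed P Q.

End Maximin.

(* Randomized adaptive algorithms: a computation may output a candidate, query
   the full vote of a voter of its choice and continue according to the answer,
   or draw an element of {0, ..., k} uniformly at random and continue
   according to it. *)
Inductive algorithm (n m : nat) : Type :=
| Output of 'I_m
| Query of 'I_n & (vote m -> algorithm n m)
| Draw (k : nat) of ('I_k.+1 -> algorithm n m).

Fixpoint prob_output (R : realType) (n m : nat) (P : profile n m) (c : 'I_m)
    (A : algorithm n m) : R :=
  match A with
  | Output d => (d == c)%:R
  | Query i f => prob_output R P c (f (P i))
  | Draw k f => (\sum_(j < k.+1) prob_output R P c (f j)) / k.+1%:R
  end.

(* Largest number of queries over all outcomes of the internal randomness;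
   querying the same voter again is counted again. *)
Fixpoint nb_queries (n m : nat) (P : profile n m) (A : algorithm n m) : nat :=
  match A with
  | Output _ => 0%N
  | Query i f => (nb_queries P (f (P i))).+1
  | Draw k f => (\max_(j < k.+1) nb_queries P (f j))%N
  end.

Definition solves_winner_determination (R : realType) (n m : nat)
    (win : profile n m -> 'I_m) (eps delta : R) (A : algorithm n m) : Prop :=
  forall P : profile n m,
    eps * n%:R <= (margin_of_victory win P)%:R ->
    1 - delta <= prob_output R P (win P) A.

Definition sample_complexity_le (R : realType) (n m : nat)
    (A : algorithm n m) (b : R) : Prop :=
  forall P : profile n m, (nb_queries P A)%:R <= b.

(* Main.v *)
(* If the maximin score of some candidate is less than 2t below that of the
   winner, then t changed votes suffice to dethrone the winner.  So when the
   margin of victory is at least max(2, eps n), the winner w leads every other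
   candidate y by at least eps n.  Hence, if z is the worst opponent of y, a
   uniformly random vote has in expectation a contribution at least eps to
   D(w, x) - D(y, z), for every x; by an exponential moment bound and a union
   bound over the pairs (x, y), all these differences are positive in a sample
   of k = O(log(m / delta) / eps^2) votes drawn with replacement, except with
   probability delta, and then w is the only maximin winner of the sample.  If
   n <= k, all votes are queried; otherwise eps n >= 2 holds. *)
Require Import Defs.
From mathcomp Require Import all_boot all_order all_algebra perm.
From mathcomp Require Import reals sequences exp ring lra zify.

Set Implicit Arguments.
Unset Strict Implicit.
Unset Printing Implicit Defensive.

Import Order.TTheory GRing.Theory Num.Theory.
Local Open Scope ring_scope.

(** * Moving one candidate to the bottom or top of a vote *)

Definition put_last m (v : vote m.+1) (w : 'I_m.+1) : vote m.+1 :=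
  (v * lift_perm (v w) ord_max 1)%g.

Definition put_first m (v : vote m.+1) (z : 'I_m.+1) : vote m.+1 :=
  (v * lift_perm (v z) ord0 1)%g.

(** [lift_perm i j 1] takes rank [i] out and reinserts it as rank [j]; the other ranks shift without
    crossing. Composed after a vote, it moves a single candidate. *)
Lemma ltn_lift_perm1 m (i j a b : 'I_m.+1) : a != i -> b != i ->
  (lift_perm i j 1%g a < lift_perm i j 1%g b)%N = (a < b)%N.
Proof.
case: (unliftP i a) => [a' ->|->]; last by rewrite eqxx.
case: (unliftP i b) => [b' ->|->]; last by rewrite eqxx.
move=> _ _; rewrite !lift_perm_lift !perm1 /= /bump.
by lia.
Qed.

Lemma prefers_put_last m (v : vote m.+1) (w x y : 'I_m.+1) : x != w ->
  prefers (put_last v w) x y = (y == w) || prefers v x y.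
Proof.
move=> xw; have vxw : v x != v w by rewrite (inj_eq perm_inj).
rewrite /prefers /put_last !permM; have [->|yw] /= := eqVneq y w.
  rewrite lift_perm_id; case: (unliftP (v w) (v x)) vxw => [k ->|->].
    by rewrite lift_perm_lift perm1 /= /bump => _; have := ltn_ord k; rewrite /=; lia.
  by rewrite eqxx.
by rewrite ltn_lift_perm1 // (inj_eq perm_inj).
Qed.

Lemma prefers_put_first m (v : vote m.+1) (z x y : 'I_m.+1) : y != z ->
  prefers (put_first v z) x y = (x == z) || prefers v x y.
Proof.
move=> yz; have vyz : v y != v z by rewrite (inj_eq perm_inj).
rewrite /prefers /put_first !permM; have [->|xz] /= := eqVneq x z.
  rewrite lift_perm_id; case: (unliftP (v z) (v y)) vyz => [k ->|->].
    by rewrite lift_perm_lift perm1.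
  by rewrite eqxx.
by rewrite ltn_lift_perm1 // (inj_eq perm_inj).
Qed.

Lemma prefersN m (v : vote m) x y : x != y -> prefers v x y = ~~ prefers v y x.
Proof.
move=> xy; rewrite /prefers -leqNgt ltn_neqAle; case: eqP => //= /val_inj/perm_inj.
by move/eqP; rewrite (negbTE xy).
Qed.

Lemma card_sum_int (T : finType) (A : {pred T}) : #|A|%:Z = \sum_(i in A) 1.
Proof. by rewrite sumr_const natz. Qed.

Lemma ord_sum_int n : n%:Z = \sum_(i < n) 1.
Proof. by rewrite sumr_const card_ord natz. Qed.

(** * Margins as sums over votes, and maximin scores *)

Definition vote_margin m (v : vote m) (x y : 'I_m) : int :=
  (prefers v x y)%:Z - (prefers v y x)%:Z.

Lemma margin_sum n m (P : profile n m) x y :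
  margin P x y = \sum_i vote_margin (P i) x y.
Proof.
have nbE a b : (nb_prefer P a b)%:Z = \sum_i (prefers (P i) a b)%:Z.
  rewrite /nb_prefer card_sum_int big_mkcond /=.
  by apply: eq_bigr => i _; rewrite inE; case: prefers.
by rewrite /margin !nbE -sumrB.
Qed.

Lemma vote_margin_le1 m (v : vote m) x y : vote_margin v x y <= 1.
Proof. by rewrite /vote_margin; do 2!case: prefers. Qed.

Lemma vote_margin_geN1 m (v : vote m) x y : -1 <= vote_margin v x y.
Proof. by rewrite /vote_margin; do 2!case: prefers. Qed.

Lemma margin_le n m (P : profile n m) x y : margin P x y <= n%:Z.
Proof.
rewrite margin_sum ord_sum_int.
by apply: ler_sum => i _; exact: vote_margin_le1.
Qed.

Lemma maximin_score_le n m (P : profile n m) x y :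
  y != x -> maximin_score P x <= margin P x y.
Proof. by move=> yx; apply: bigmin_le_cond. Qed.

Lemma maximin_score_attained n m (P : profile n m) x z : z != x ->
  exists2 y, y != x & maximin_score P x = margin P x y.
Proof.
move=> zx; rewrite /maximin_score.
have [y yx ->] := eq_bigmin z (fun y => y != x) (margin P x) zx
  (fun y _ => margin_le P x y).
by exists y.
Qed.

Lemma maximin_winner_cowinner n m (tie : tie_rule n m) (P : profile n m) :
  valid_tie_rule tie -> maximin_winner tie P \in maximin_cowinners P.
Proof.
apply; apply/set0Pn.
(* The value of [tie] at the empty set only shows that some candidate exists. *)
have x0 : 'I_m := tie P set0.
have [x _ xmax] := @arg_maxP _ _ _ x0 predT (maximin_score P) isT.
by exists x; rewrite inE; apply/forallP => y; exact: xmax.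
Qed.

Lemma margin_of_victory_le n m (win : profile n m -> 'I_m) P Q :
  win Q != win P -> (margin_of_victory win P <= nb_changed P Q)%N.
Proof.
by move=> QP; rewrite /margin_of_victory -minEnat -leEnat; apply: bigmin_le_cond.
Qed.

Lemma margin_of_victory_le_n n m (win : profile n m -> 'I_m) P :
  (margin_of_victory win P <= n)%N.
Proof. by rewrite /margin_of_victory -minEnat -leEnat; apply: bigmin_le_id. Qed.

Lemma maximin_winner_neq n m (tie : tie_rule n m) (Q : profile n m) w y :
  valid_tie_rule tie -> maximin_score Q w < maximin_score Q y ->
  maximin_winner tie Q != w.
Proof.
move=> vtie wy; have := maximin_winner_cowinner Q vtie; rewrite inE => /forallP /(_ y).
by apply: contraTneq => ->; rewrite -ltNge.
Qed.

(** * Margin of victory and score gaps *)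

Definition alter n m (f : vote m -> vote m) (T : {set 'I_n}) (P : profile n m) :
  profile n m := [ffun i => if i \in T then f (P i) else P i].

Lemma nb_changed_alter n m f T (P : profile n m) :
  (nb_changed P (alter f T P) <= #|T|)%N.
Proof.
apply/subset_leq_card/subsetP => i; rewrite inE ffunE.
by case: ifP => //; rewrite eqxx.
Qed.

Lemma ler_margin n m (P Q : profile n m) x y :
  (forall i, vote_margin (P i) x y <= vote_margin (Q i) x y) ->
  margin P x y <= margin Q x y.
Proof. by move=> PQ; rewrite !margin_sum ler_sum. Qed.

Lemma ler_maximin_score n m (P Q : profile n m) x :
  (forall y, y != x -> margin P x y <= margin Q x y) ->
  maximin_score P x <= maximin_score Q x.
Proof. exact: le_bigmin2. Qed.

Lemma sub_card_set (T : finType) (A : {set T}) k :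
  (k <= #|A|)%N -> exists2 B : {set T}, B \subset A & #|B| = k.
Proof.
rewrite -bin_gt0 -cards_draws => /card_gt0P [B]; rewrite inE => /andP [BA /eqP].
by exists B.
Qed.

(* If at least t voters prefer w to its worst opponent z, t of them send w to
   the bottom; otherwise all of them, and one more voter, send z to the top, so
   that w is beaten unanimously by z while z is not beaten unanimously. *)
Lemma margin_of_victory_gap n m (tie : tie_rule n m) (P : profile n m) y t :
  (0 < n)%N -> valid_tie_rule tie -> y != maximin_winner tie P ->
  maximin_score P (maximin_winner tie P) - maximin_score P y < (t%:Z *+ 2) ->
  (margin_of_victory (maximin_winner tie) P <= t)%N.
Proof.
case: m tie P y => [|m] tie P y; first by case: y.
set w := maximin_winner tie P => n0 vtie yw gap.
suff [T [f [Tt [x wx]]]] : exists (T : {set 'I_n}) (f : vote m.+1 -> vote m.+1),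
    (#|T| <= t)%N /\ exists x,
    maximin_score (alter f T P) w < maximin_score (alter f T P) x.
  apply: leq_trans Tt; apply: leq_trans (nb_changed_alter f T P).
  exact/margin_of_victory_le/maximin_winner_neq/wx.
have [z zw wz] := maximin_score_attained P yw.
have wz' : w != z by rewrite eq_sym.
pose A := [set i : 'I_n | prefers (P i) w z].
have [tA|At] := leqP t #|A|.
  have [T TA Tt] := sub_card_set tA.
  exists T, (fun v => put_last v w); split; first by rewrite Tt.
  exists y; set Q := alter _ T P.
  (* Each voter in [T] preferred [w] to [z] and now reverses this, which costs [w] two points. *)
  have Qw : margin Q w z = margin P w z - t%:Z *+ 2.
    rewrite !margin_sum -Tt card_sum_int -sumrMnl.
    rewrite [X in _ - X]big_mkcond /= -sumrB; apply: eq_bigr => i _.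
    rewrite ffunE; case: ifP => [iT|_]; last by rewrite subr0.
    have /subsetP/(_ _ iT) := TA; rewrite inE => wz_i.
    rewrite /vote_margin (prefersN _ wz') prefers_put_last // eqxx /=.
    by rewrite wz_i (prefersN _ zw) wz_i.
  (* Sending [w] down can only help [y] against [w], and leaves the other contests of [y] as they
     were. *)
  have Qy : maximin_score P y <= maximin_score Q y.
    apply: ler_maximin_score => x xy; apply: ler_margin => i.
    rewrite ffunE; case: ifP => // _; rewrite /vote_margin prefers_put_last //.
    have [->|xw] := eqVneq x w; last by rewrite prefers_put_last // (negbTE yw).
    have -> : prefers (put_last (P i) w) w y = false.
      by rewrite prefersN 1?eq_sym // prefers_put_last // eqxx.
    by case: prefers; case: prefers.
  apply: le_lt_trans (maximin_score_le Q zw) _; apply: lt_le_trans Qy.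
  by rewrite Qw -wz ltrBlDr addrC -ltrBlDr.
(* As [A] may be empty, [i0] guarantees a vote with [z] on top; it adds at most one voter, which
   [#|A| < t] allows. *)
pose i0 := Ordinal n0.
exists (i0 |: A), (fun v => put_first v z); split.
  by rewrite cardsU1; apply: leq_trans At; rewrite -add1n leq_add2r leq_b1.
exists z; set Q := alter _ _ P.
have Qz i : ~~ prefers (Q i) w z.
  rewrite ffunE; case: ifP => [_|].
    by rewrite -prefersN // prefers_put_first // eqxx.
  by rewrite !inE; case: eqP => //= _ ->.
have Qw : maximin_score Q w <= - n%:Z.
  apply: le_trans (maximin_score_le Q zw) _.
  rewrite margin_sum ord_sum_int -sumrN.
  by apply: ler_sum => i _; rewrite /vote_margin (prefersN _ zw) (negbTE (Qz i)).
apply: le_lt_trans Qw _; have [x xz ->] := maximin_score_attained Q wz'.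
rewrite margin_sum ord_sum_int -sumrN.
rewrite (bigD1 i0) //= [X in _ < X](bigD1 i0) //=; apply: ltr_leD.
  by rewrite ffunE setU11 /vote_margin (prefersN _ xz) prefers_put_first // eqxx.
by apply: ler_sum => i _; exact: vote_margin_geN1.
Qed.

(** * Exponential moments of bounded variables *)

Lemma ler_expR_quadratic (R : realType) (x : R) :
  x <= 1/2 -> expR x <= 1 + x + 2 * x ^+ 2.
Proof.
move=> x2; have := expR_ge1Dx (- x); rewrite expRN => h.
have e0 := expR_gt0 x.
have : (1 - x) * expR x <= 1.
  by have := ler_wpM2r (ltW e0) h; rewrite mulVf ?gt_eqF.
(* It is enough to dominate [1 / (1 - x)], which bounds [expR x]. *)
have : 1 <= (1 - x) * (1 + x + 2 * x ^+ 2).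
  have -> : (1 - x) * (1 + x + 2 * x ^+ 2) = 1 + x ^+ 2 * (1 - 2 * x) by ring.
  by rewrite lerDl mulr_ge0 ?sqr_ge0 //; lra.
move=> h1 h2; rewrite -(ler_pM2l (_ : 0 < 1 - x)); last by lra.
exact: le_trans h2 h1.
Qed.

(** With parameter [eps / 16], the linear term of the quadratic bound gains [eps ^+ 2 / 16] on
    average, and the quadratic term loses at most [2 * (eps / 16) ^+ 2 * 4 = eps ^+ 2 / 32]. *)
Lemma mean_expR_le (R : realType) n (X : 'I_n.+1 -> R) (eps : R) :
  0 <= eps -> eps <= 1 -> (forall j, `|X j| <= 2) ->
  eps * n.+1%:R <= \sum_j X j ->
  (\sum_j expR (- (eps / 16 * X j))) / n.+1%:R <= expR (- (eps ^+ 2 / 32)).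
Proof.
move=> eps0 eps1 X2 EX; apply: le_trans (expR_ge1Dx _).
rewrite ler_pdivrMr ?ltr0n //.
apply: (@le_trans _ _ (\sum_j ((1 + eps ^+ 2 / 32) - eps / 16 * X j))).
  apply: ler_sum => j _; have := X2 j; rewrite ler_norml => /andP [Xl Xu].
  apply: le_trans (ler_expR_quadratic _) _; first by nra.
  have : X j ^+ 2 <= 4 by nra.
  have : 0 <= eps ^+ 2 by apply: sqr_ge0.
  rewrite sqrrN exprMn expr_div_n => h h'.
  have : eps ^+ 2 * X j ^+ 2 <= eps ^+ 2 * 4 by rewrite ler_wpM2l.
  by lra.
rewrite sumrB -mulr_sumr sumr_const card_ord -[X in X - _]mulr_natr.
have := ler_wpM2l eps0 EX; rewrite mulrA -expr2 => h.
by rewrite !mulrDl mul1r; lra.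
Qed.

(** * Sampling votes with replacement *)

Fixpoint sample_votes n m (k : nat) (s : seq (vote m)) (F : seq (vote m) -> 'I_m) :
  algorithm n.+1 m :=
  if k is k'.+1 then
    Draw (fun j : 'I_n.+1 => Query j (fun v => sample_votes n k' (v :: s) F))
  else Output n.+1 (F s).

Lemma nb_queries_sample_votes n m (P : profile n.+1 m) k s F :
  nb_queries P (sample_votes n k s F) = k.
Proof.
elim: k s => [|k IHk] s //=.
rewrite (eq_bigr (fun=> k.+1)) => [|j _]; last by rewrite IHk.
by apply/eqP; rewrite eqn_leq (leq_bigmax ord0) andbT; apply/bigmax_leqP.
Qed.

(* The sum on the right is a supermartingale of the sampling process which
   dominates the indicator of a wrong output. *)
Lemma sample_votes_error (R : realType) n m (P : profile n.+1 m) w F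
    (T : finType) (D : pred T) (Y : T -> vote m -> R) (lambda rho : R) :
  0 <= lambda -> 0 <= rho ->
  (forall s, F s != w -> exists2 t, D t & \sum_(v <- s) Y t v <= 0) ->
  (forall t, D t -> (\sum_j expR (- (lambda * Y t (P j)))) / n.+1%:R <= rho) ->
  forall k s, 1 - prob_output R P w (sample_votes n k s F) <=
    rho ^+ k * \sum_(t | D t) expR (- (lambda * \sum_(v <- s) Y t v)).
Proof.
move=> lambda0 rho0 hF hrho; elim=> [|k IHk] s /=.
  rewrite mul1r; have [_|/hF [t Dt Yt]] := eqVneq (F s) w.
    by rewrite subrr; apply: sumr_ge0 => t _; exact: expR_ge0.
  rewrite subr0 (bigD1 t) //=; apply: ler_wpDr.
    by apply: sumr_ge0 => u _; exact: expR_ge0.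
  by rewrite -expR0 ler_expR oppr_ge0 mulr_ge0_le0.
pose p j := prob_output R P w (sample_votes n k (P j :: s) F).
have -> : 1 - (\sum_j p j) / n.+1%:R = (\sum_j (1 - p j)) / n.+1%:R.
  by rewrite sumrB sumr_const card_ord mulrBl divff // pnatr_eq0.
rewrite ler_pdivrMr ?ltr0n //.
apply: le_trans (ler_sum _ (fun j _ => IHk (P j :: s))) _.
rewrite -mulr_sumr exchange_big /= exprSr -!mulrA ler_wpM2l //.
  by rewrite exprn_ge0 .
rewrite mulr_suml mulr_sumr; apply: ler_sum => t Dt.
(* The newly drawn vote contributes an independent factor, whose mean is at most [rho]. *)
under eq_bigr do rewrite big_cons mulrDr opprD expRD.
rewrite -mulr_suml [_ * n.+1%:R]mulrC mulrA ler_wpM2r ?expR_ge0 //.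
by rewrite -ler_pdivrMr ?ltr0n ?hrho.
Qed.

(** * The maximin winner of a sample *)

Definition profile_of_seq m (s : seq (vote m)) : profile (size s) m :=
  [ffun i => tnth (in_tuple s) i].

Lemma margin_profile_of_seq m (s : seq (vote m)) x y :
  margin (profile_of_seq s) x y = \sum_(v <- s) vote_margin v x y.
Proof.
by rewrite margin_sum [RHS]big_tnth; apply: eq_bigr => i _; rewrite ffunE.
Qed.

Definition sample_winner m (d : 'I_m) (s : seq (vote m)) : 'I_m :=
  odflt d [pick x in maximin_cowinners (profile_of_seq s)].

(** Any opponent [z y] bounds the sample score of [y] from above. So if no pair is bad, [w] scores
    strictly more than every other candidate and is the only cowinner. *)
Lemma sample_winner_error m (d w : 'I_m) (z : 'I_m -> 'I_m) s :
  (2 <= m)%N -> (forall y, y != w -> z y != y) -> sample_winner d s != w ->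
  exists2 p : 'I_m * 'I_m, (p.1 != w) && (p.2 != w) &
    \sum_(v <- s) vote_margin v w p.1 <= \sum_(v <- s) vote_margin v p.2 (z p.2).
Proof.
move=> m2 zy sw; apply/exists_inP; apply: contraNT sw.
rewrite negb_exists_in => /forall_inP beats.
have [u uw] : exists u : 'I_m, u != w.
  case: m m2 w {d z zy s beats} => [|[|m]] // _ w.
  exists (if w == ord0 then ord_max else ord0).
  by case: ifP => [/eqP ->|/negbT]; rewrite // eq_sym.
set S := profile_of_seq s.
have lose y : y != w -> maximin_score S y < maximin_score S w.
  move=> yw; have [x xw ->] := maximin_score_attained S uw.
  apply: le_lt_trans (maximin_score_le S (zy y yw)) _.
  rewrite !margin_profile_of_seq ltNge.
  by apply: (beats (x, y)); rewrite /= xw yw.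
rewrite /sample_winner; case: pickP => [x|/(_ w)] /=.
  rewrite inE => /forallP /(_ w); apply: contraTT => xw.
  by rewrite -ltNge lose.
rewrite inE => /negbT /forallPn [y].
have [->|yw] := eqVneq y w; first by rewrite lexx.
by rewrite (ltW (lose y yw)).
Qed.

(** * Querying every voter *)

Fixpoint query_all n m (F : profile n m -> 'I_m) (s : seq 'I_n) (Q : profile n m) :
  algorithm n m :=
  if s is i :: s' then
    Query i (fun v => query_all F s' [ffun j => if j == i then v else Q j])
  else Output n (F Q).

Lemma nb_queries_query_all n m F s (P Q : profile n m) :
  nb_queries P (query_all F s Q) = size s.
Proof. by elim: s Q => [|i s IHs] Q //=; rewrite IHs. Qed.

Lemma prob_output_query_all (R : realType) n m F s (P Q : profile n m) c :
  (forall i, i \notin s -> Q i = P i) ->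
  prob_output R P c (query_all F s Q) = (F P == c)%:R.
Proof.
elim: s Q => [|i s IHs] Q QP /=.
  by have -> : Q = P by apply/ffunP => i; exact: QP.
apply: IHs => j js; rewrite ffunE; case: eqVneq => [->|ji] //.
by apply: QP; rewrite inE negb_or ji.
Qed.

(** * The algorithm and its sample size *)

Definition sample_size (R : realType) (m : nat) (eps delta : R) : nat :=
  (Num.truncn (64 * (ln (m%:R / delta) / eps ^+ 2))).+1.

(** For [1 < eps] and at least one voter, no profile meets the promise, since the margin of victory
    is at most the number of voters; any output will do. *)
Definition maximin_algorithm (R : realType) n m :
    tie_rule n m -> R -> R -> algorithm n m :=
  match n with
  | 0%N => fun tie _ _ => Output 0 (tie [ffun=> 1%g] set0)
  | n'.+1 => fun tie eps delta =>
    let P0 : profile n'.+1 m := [ffun=> 1%g] in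
    let d := tie P0 set0 in
    let k := sample_size m eps delta in
    if 1 < eps then Output n'.+1 d
    else if (n'.+1 <= k)%N then query_all (maximin_winner tie) (enum 'I_n'.+1) P0
    else sample_votes n' k [::] (sample_winner d)
  end.

Section Bounds.

Variables (R : realType) (m : nat) (eps delta : R).
Hypotheses (m2 : (2 <= m)%N) (eps0 : 0 < eps).
Hypotheses (delta0 : 0 < delta) (delta1 : delta < 1).

Let L := ln (m%:R / delta).

Lemma expRN_ln_ratio : expR (- L) = delta / m%:R.
Proof.
rewrite expRN lnK ?invf_div // posrE divr_gt0 // ltr0n.
exact: leq_trans m2.
Qed.

(** This lower bound lets the rounding of the sample size be absorbed into the constant:
    [1 <= 2 * (L / eps ^+ 2)] when [eps <= 1]. *)
Lemma ln_ratio_ge : 1 / 2 <= L.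
Proof.
have := expR_ge1Dx (- L); rewrite expRN_ln_ratio => h.
suff : delta / m%:R <= 1 / 2 by lra.
have m0 : 0 < m%:R :> R by rewrite ltr0n; exact: leq_trans m2.
have M2 : 2 <= m%:R :> R by rewrite ler_nat.
rewrite ler_pdivrMr //; move: (m%:R) M2 delta1 => M; lra.
Qed.

Lemma sample_size_ge : 64 * (L / eps ^+ 2) <= (sample_size m eps delta)%:R.
Proof. exact/ltW/truncnS_gt. Qed.

Lemma sample_size_le : eps <= 1 ->
  (sample_size m eps delta)%:R <= 66 * (L / eps ^+ 2).
Proof.
move=> eps1; have L2 := ln_ratio_ge.
have e0 : 0 < eps ^+ 2 by rewrite exprn_gt0.
have e1 : eps ^+ 2 <= 1 by rewrite expr_le1 // ltW.
have Le : 1 / 2 <= L / eps ^+ 2.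
  by rewrite ler_pdivlMr //; nra.
rewrite /sample_size -natr1.
have /andP [h _] : (Num.truncn (64 * (L / eps ^+ 2)))%:R <= 64 * (L / eps ^+ 2)
    < (Num.truncn (64 * (L / eps ^+ 2))).+1%:R by apply: truncn_itv; lra.
by rewrite -/L; lra.
Qed.

(** The factor 64 makes the exponent at least [2 * L], so the power is at most [(delta / m) ^+ 2];
    the union bound over [m ^+ 2] pairs then leaves [delta ^+ 2]. *)
Lemma sampling_failure_le :
  expR (- (eps ^+ 2 / 32)) ^+ sample_size m eps delta * m%:R ^+ 2 <= delta.
Proof.
rewrite -expRM_natl.
have m0 : 0 < m%:R :> R by rewrite ltr0n; exact: leq_trans m2.
have e0 : 0 < eps ^+ 2 by rewrite exprn_gt0.
apply: (@le_trans _ _ (expR (2%:R * - L) * m%:R ^+ 2)).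
  rewrite ler_wpM2r ?sqr_ge0 // ler_expR.
  have := sample_size_ge; rewrite mulrA ler_pdivrMr // => h.
  by lra.
rewrite expRM_natl expRN_ln_ratio expr_div_n divfK ?expf_neq0 ?gt_eqF //.
by rewrite expr2 ger_pMr // ltW.
Qed.

End Bounds.

(** * Correctness of sampling and the final bounds *)

Lemma sample_votes_correct (R : realType) n m (tie : tie_rule n.+1 m)
    (eps delta : R) (d : 'I_m) (P : profile n.+1 m) :
  (2 <= m)%N -> valid_tie_rule tie -> 0 < eps -> eps <= 1 ->
  0 < delta -> delta < 1 -> 2 <= eps * n.+1%:R ->
  eps * n.+1%:R <= (margin_of_victory (maximin_winner tie) P)%:R ->
  1 - delta <= prob_output R P (maximin_winner tie P)
    (sample_votes n (sample_size m eps delta) [::] (sample_winner d)).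
Proof.
move=> m2 vtie eps0 eps1 delta0 delta1 epsn mov.
set w := maximin_winner tie P in mov *.
(* The implication makes the choice of a worst opponent total; its value at [w] is arbitrary. *)
have worst y : exists z, (y != w) ==> (z != y) && (maximin_score P y == margin P y z).
  have [_|yw] := eqVneq y w; first by exists y.
  have wy : w != y by rewrite eq_sym.
  by have [z zy ->] := maximin_score_attained P wy; exists z; rewrite zy eqxx.
pose z y := xchoose (worst y).
have zP y : y != w -> z y != y /\ maximin_score P y = margin P y (z y).
  by move=> yw; have /implyP/(_ yw)/andP [? /eqP] := xchooseP (worst y).
pose Y (p : 'I_m * 'I_m) v : R :=
  (vote_margin v w p.1 - vote_margin v p.2 (z p.2))%:~R.
pose D (p : 'I_m * 'I_m) := (p.1 != w) && (p.2 != w).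
have Y2 p v : `|Y p v| <= 2.
  rewrite /Y -intr_norm -[2]/(2%:~R) ler_int.
  have := vote_margin_le1 v w p.1; have := vote_margin_geN1 v w p.1.
  have := vote_margin_le1 v p.2 (z p.2); have := vote_margin_geN1 v p.2 (z p.2).
  by rewrite ler_norml; lia.
have EY p : D p -> eps * n.+1%:R <= \sum_j Y p (P j).
  move=> /andP [xw yw]; have [_ sy] := zP _ yw.
  rewrite /Y -rmorph_sum sumrB -!margin_sum -sy /=.
  apply: (le_trans mov); rewrite pmulrn ler_int.
  apply: le_trans (lerB (maximin_score_le P xw) (lexx _)).
  set M := margin_of_victory _ P in mov *.
  have M2 : (2 <= M)%N by rewrite -(ler_nat R); apply: le_trans mov.
  (* A smaller gap would let [M.-1] changes dethrone [w]. As [2 <= M], twice [M.-1] is still at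
     least [M]. *)
  have gap : M.-1%:Z *+ 2 <= maximin_score P w - maximin_score P p.2.
    rewrite leNgt; apply/negP => /(margin_of_victory_gap (ltn0Sn n) vtie yw).
    by rewrite -/w -/M; lia.
  apply: le_trans gap; lia.
have err s : sample_winner d s != w -> exists2 p, D p & \sum_(v <- s) Y p v <= 0.
  move=> /(sample_winner_error m2 (fun y yw => (zP y yw).1)) [p Dp le_p].
  exists p => //; rewrite /Y -rmorph_sum sumrB /= lerz0.
  by rewrite subr_le0.
have lam0 : 0 <= eps / 16 by lra.
rewrite lerBlDr -lerBlDl.
apply: le_trans (sample_votes_error lam0 (expR_ge0 _) err
  (fun p Dp => mean_expR_le (ltW eps0) eps1 (fun j => Y2 p (P j)) (EY p Dp)) _ _) _.
apply: le_trans (sampling_failure_le m2 eps0 delta0 delta1).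
rewrite ler_wpM2l ?exprn_ge0 ?expR_ge0 //.
(* On the empty sample every term is 1, so the sum counts the pairs. *)
under eq_bigr do rewrite big_nil mulr0 oppr0 expR0.
rewrite sumr_const -natrX ler_nat.
by apply: leq_trans (max_card _) _; rewrite card_prod card_ord mulnn.
Qed.

Theorem theorem8 (R : realType) :
  exists (C : R)
    (A : forall n m : nat, tie_rule n m -> R -> R -> algorithm n m),
    0 < C /\
    forall (n m : nat) (tie : tie_rule n m) (eps delta : R),
      (1 <= n)%N -> (2 <= m)%N -> valid_tie_rule tie ->
      0 < eps -> 0 < delta -> delta < 1 ->
      solves_winner_determination (maximin_winner tie) eps delta
        (A n m tie eps delta) /\
      sample_complexity_le (A n m tie eps delta)
        (C * (ln (m%:R / delta) / eps ^+ 2)).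
Proof.
exists 66, (@maximin_algorithm R); split => //.
case=> [|n] m tie eps delta // _ m2 vtie eps0 delta0 delta1 /=.
have L2 := ln_ratio_ge m2 delta0 delta1.
have e0 : 0 < eps ^+ 2 by rewrite exprn_gt0.
have [eps_gt1|eps1] := ltP 1 eps; split=> P /=.
- move=> mov; have := lt_le_trans _ mov; move=> /(_ n.+1%:R).
  rewrite ltr_pMl ?ltr0n // => /(_ eps_gt1).
  by rewrite ltr_nat ltnNge margin_of_victory_le_n.
- by rewrite /= mulr_ge0 // divr_ge0 ?(ltW e0) //; apply: le_trans L2; lra.
- case: ifP => [_ _|/negbT].
    rewrite prob_output_query_all => [|i]; last by rewrite mem_enum.
    by rewrite eqxx mulr1n gerBl ltW.
  rewrite -ltnNge => kn mov; apply: sample_votes_correct => //.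
  have kL := sample_size_ge m eps delta.
  have kn' : (sample_size m eps delta)%:R <= n.+1%:R :> R by rewrite ler_nat ltnW.
  (* Here [n.+1] exceeds the sample size, which is at least [64 * (L / eps ^+ 2)] with
     [1 / 2 <= L]. *)
  have h : 32 <= eps ^+ 2 * n.+1%:R.
    rewrite mulrC -ler_pdivrMr //; apply: le_trans (le_trans kL kn').
    by rewrite mulrA ler_pM2r ?invr_gt0 //; lra.
  have : eps ^+ 2 * n.+1%:R <= eps * n.+1%:R.
    by rewrite ler_pM2r ?ltr0n // expr2 ger_pMr.
  by move=> h'; apply: le_trans h'; apply: le_trans h; lra.
apply: le_trans (sample_size_le m2 eps0 delta0 delta1 eps1); rewrite ler_nat.
case: ifP => [nk|_]; first by rewrite nb_queries_query_all size_enum_ord.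
exact/eq_leq/(nb_queries_sample_votes P (sample_size m eps delta) [::]).
Qed.
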